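(* Let $\mathbf{n}=(n_1,\dots,n_l)$ with $0\le n_1\le n_2\le\cdots\le n_l\le N$. (i) Let $\lambda$ be the hook shape $(a,1^b)$ with $a\ge1$ and $b=l-1\ge0$. Then in $\mathcal{U}/I_{\mathrm{KR}}^{\mathrm{st}}$, $J_\lambda^{\mathbf{n}}=\sum_{T\in\mathrm{SYT}(\lambda')^{\mathbf{n}}}\mathrm{creading}(T)$. (ii) If $a\ge2$, $\lambda=(a,2)$ and $l=2$, then in $\mathcal{U}/I_{\mathrm{KR}}^{\mathrm{st}}$, $J_\lambda^{\mathbf{n}}=\sum_{T\in\mathrm{SYT}(\lambda')^{\mathbf{n}},\,T_{1,2}>T_{2,1}}\mathrm{creading}(T)+\sum_{T\in\mathrm{SYT}(\lambda')^{\mathbf{n}},\,T_{1,2}<T_{2,1}}\mathrm{reading}(T)$. In particular, $\mathfrak{J}_\lambda(\mathbf{u})$ is a positive sum of monomials in $\mathcal{U}/I_{\mathrm{KR}}^{\mathrm{st}}$ if $\lambda$ is a hook shape or of the form $(a,2)'$.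
   Context: $\mathcal{U}=\mathbb{Z}\langle u_1,\dots,u_N\rangle$, the letter $a$ denotes $u_a$, monomials are words. $I_{\mathrm{KR}}^{\mathrm{st}}$ is the two-sided ideal generated by $b(ac-ca)-(ac-ca)b$ ($a<b<c$) and all words with a repeated letter. For $0\le m\le N$ and $d>0$, $e_d([m])=\sum_{m\ge i_1>\cdots>i_d\ge1}u_{i_1}\cdots u_{i_d}$, $e_0([m])=1$, $e_d([m])=0$ for $d<0$ (so $e_d([0])=0$ for $d\ne0$). For a weak composition $\alpha=(\alpha_1,\dots,\alpha_l)$, $J_\alpha^{\mathbf{n}}=\sum_{\pi\in S_l}\mathrm{sgn}(\pi)e_{\alpha_1+\pi(1)-1}([n_1])\cdots e_{\alpha_l+\pi(l)-l}([n_l])$. For a partition $\lambda$, $\mathfrak{J}_\lambda(\mathbf{u})=J_{\lambda'}^{N,\dots,N}$ with $\lambda'$ the conjugate partition. Tableaux use English convention; $T_{r,c}$ is the entry in row $r$, column $c$. $\mathrm{SYT}(\mu)^{\mathbf{n}}$ is the set of semistandard Young tableaux of shape $\mu$ (rows weakly increasing, columns strictly increasing) with no repeated entry and with all entries in column $c$ lying in $[n_c]$. $\mathrm{reading}(T)$ concatenates the rows, each read left to right, starting with the bottom row; $\mathrm{creading}(T)$ concatenates the columns, each read bottom to top, starting with the leftmost column. A positive sum of monomials in $\mathcal{U}/I$ means congruent modulo $I$ to a nonnegative integer combination of words. *)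

(* Defs.v *)
From mathcomp Require Import all_boot all_order all_algebra perm.
From mathcomp Require Import monalg.

Set Implicit Arguments.
Unset Strict Implicit.
Unset Printing Implicit Defensive.

Import GRing.Theory.
Local Open Scope ring_scope.

(* Z<u_1, ..., u_N> as the integral monoid algebra of the free monoid on 'I_N;
   indices are 0-based, so the letter u_i is the ordinal of value i - 1 and
   the alphabet [m] is the set of ordinals i < m. *)
Notation freeZ N := {malg int[{fmonom 'I_N}]}.

Definition word N (w : seq 'I_N) : freeZ N := mkmalgU (FMonom w) 1.

Definition letter N (i : 'I_N) : freeZ N := word [:: i].

Lemma word_cat N (v w : seq 'I_N) : word (v ++ w) = word v * word w.
Proof.
rewrite malgM_def /fgmul; apply/esym; rewrite [LHS]fgmulUU mulr1 /word.
by congr mkmalgU; apply: val_inj; rewrite /= fmM.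
Qed.

Lemma word_nil N : word [::] = 1 :> freeZ N.
Proof.
by rewrite /word; congr mkmalgU; apply: val_inj; rewrite /= fm1.
Qed.

Inductive two_sided_ideal (R : pzRingType) (S : R -> Prop) : R -> Prop :=
| tsi_gen x of S x : two_sided_ideal S x
| tsi_zero : two_sided_ideal S 0
| tsi_add x y of two_sided_ideal S x & two_sided_ideal S y :
    two_sided_ideal S (x + y)
| tsi_mull x y of two_sided_ideal S y : two_sided_ideal S (x * y)
| tsi_mulr x y of two_sided_ideal S x : two_sided_ideal S (x * y).

Inductive KRst_gen (N : nat) : freeZ N -> Prop :=
| KRst_triple (a b c : 'I_N) of (a < b)%N & (b < c)%N :
    KRst_gen (letter b * (letter a * letter c - letter c * letter a)
              - (letter a * letter c - letter c * letter a) * letter b)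
| KRst_repeat (w : seq 'I_N) of ~~ uniq w : KRst_gen (word w).

Definition I_KRst (N : nat) : freeZ N -> Prop :=
  two_sided_ideal (@KRst_gen N).

(* Equality in the quotient ring U / I_KR^st. *)
Definition eq_KRst (N : nat) (x y : freeZ N) : Prop := I_KRst (x - y).

Definition positive_KRst (N : nat) (x : freeZ N) : Prop :=
  exists p : freeZ N, (forall w, (0 <= p@_w)%R) /\ eq_KRst x p.

Definition elem (N : nat) (d : int) (m : nat) : freeZ N :=
  if d is Posz k then
    \sum_(w : k.-tuple 'I_N | sorted gtn (map val w)
                              && all (fun i : 'I_N => (i < m)%N) w) word w
  else 0.

(* The degrees use s i - i = pi(i) - i, unaffected by 0-based indexing;
   the product is taken in increasing order of i. *)
Definition flaggedJ (N : nat) (alpha n : seq nat) : freeZ N :=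
  \sum_(s : 'S_(size alpha)) (-1) ^+ s *
    \prod_(i < size alpha)
      elem N ((nth 0%N alpha i)%:Z + (s i)%:Z - i%:Z) (nth 0%N n i).

Definition conjugate (la : seq nat) : seq nat :=
  [seq count (fun p => (j < p)%N) la | j <- iota 0 (head 0%N la)].

Definition hook (la : seq nat) : Prop :=
  exists a b : nat, (1 <= a)%N /\ la = a :: nseq b 1%N.

Definition schurJ (N : nat) (la : seq nat) : freeZ N :=
  flaggedJ N (conjugate la) (nseq (size (conjugate la)) N).

(* A tableau is the list of its rows, from top to bottom. *)
Definition tableau (N : nat) := seq (seq 'I_N).

Definition column N (T : tableau N) (c : nat) : seq 'I_N :=
  pmap (fun r => onth r c) T.

(* Entry in (0-based) row r and column c; 0 outside of the shape. *)
Definition entry N (T : tableau N) (r c : nat) : nat :=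
  nth 0%N (map val (nth [::] T r)) c.

Definition reading N (T : tableau N) : seq 'I_N := flatten (rev T).

Definition creading N (T : tableau N) : seq 'I_N :=
  flatten [seq rev (column T c) | c <- iota 0 (size (head [::] T))].

Definition is_syt N (n : seq nat) (T : tableau N) : bool :=
  [&& all (fun r : seq 'I_N => sorted leq (map val r)) T,
      all (fun c => sorted ltn (map val (column T c)))
          (iota 0 (size (head [::] T))),
      uniq (flatten T)
    & all (fun c => all (fun i : 'I_N => (i < nth 0 n c)%N) (column T c))
          (iota 0 (size (head [::] T)))].

(* SYT(mu)^n, enumerated without repetition: see mem_SYT and SYT_uniq. *)
Definition SYT (N : nat) (mu n : seq nat) : seq (tableau N) :=
  [seq T <- [seq reshape mu (val t) | t <- enum {: (sumn mu).-tuple 'I_N}]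
         | is_syt n T].

Lemma mem_SYT N mu n (T : tableau N) :
  (T \in SYT N mu n) = (shape T == mu) && is_syt n T.
Proof.
rewrite mem_filter andbC; congr (_ && _).
apply/mapP/eqP => [[t _ ->]|<-].
  by rewrite reshapeKl // size_tuple.
have sz : size (flatten T) == sumn (shape T) by rewrite size_flatten.
by exists (Tuple sz); rewrite ?mem_enum //= flattenK.
Qed.

Lemma SYT_uniq N mu n : uniq (SYT N mu n).
Proof.
apply: filter_uniq; rewrite map_inj_uniq ?enum_uniq // => s t /(congr1 flatten).
by rewrite !reshapeKr ?size_tuple // => /val_inj.
Qed.

(* Main.v *)
Require Import Defs.
From mathcomp Require Import all_boot all_order all_algebra.
From mathcomp Require Import monalg.
From mathcomp Require Import perm zify.

(* Expand every product of e's as a signed sum of words.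

   Hook: the determinant is of Hessenberg type, and its first column gives
   J(a, 1^(b+1)) = e_a J(1, 1^b) - J(a+1, 1^b), the flag n_2 being dropped in
   the last term.  On words, a decreasing word is followed by a weakly
   increasing one, and the subtraction removes the words that descend at the
   junction.  What is left are the column readings of the semistandard hook
   tableaux, so that only the vanishing of words with a repeated letter is
   used.

   (a, 2): J = e_a e_2 - e_(a+1) e_1.  Group the words by their first a - 1
   letters, the last of which is called p.  The words in the three remaining
   letters i, j, k are compared with the readings of the tableaux: when p, i,
   j, k are distinct, the difference is a sum of the relations
   acb + bca = bac + cab with a < b < c and b < p. *)

Set Implicit Arguments.
Unset Strict Implicit.
Unset Printing Implicit Defensive.

Import GRing.Theory Num.Theory.
Local Open Scope ring_scope.

(** * Sums over all words of a given length *)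

Section WordSums.
Variable N : nat.
Implicit Type F G : seq 'I_N -> freeZ N.

(** The summand takes a plain sequence, so words can be cut, joined and reversed without casts
    between tuple types. *)
Definition wsum k F : freeZ N := \sum_(w : k.-tuple 'I_N) F w.

Lemma eq_wsum k F G :
  (forall w, size w = k -> F w = G w) -> wsum k F = wsum k G.
Proof. by move=> eqFG; apply: eq_bigr => w _; rewrite eqFG ?size_tuple. Qed.

Lemma wsum0 F : wsum 0 F = F [::].
Proof.
by rewrite /wsum (big_pred1 [tuple]) // => w; apply/esym/eqP; exact: tuple0.
Qed.

Lemma wsumS k F : wsum k.+1 F = \sum_i wsum k (fun v => F (i :: v)).
Proof.
rewrite /wsum pair_big /=.
rewrite (reindex (fun p : 'I_N * k.-tuple 'I_N => [tuple of p.1 :: p.2])) //=.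
exists (fun t : k.+1.-tuple 'I_N => (thead t, behead_tuple t)) => [[x t]|t] _.
  by congr (_, _); apply: val_inj.
by rewrite [RHS]tuple_eta.
Qed.

Lemma wsum_cat k l F :
  wsum (k + l) F = wsum k (fun u => wsum l (fun v => F (u ++ v))).
Proof.
elim: k F => [|k IHk] F; first by rewrite wsum0.
by rewrite addSn !wsumS; apply: eq_bigr => i _; rewrite IHk.
Qed.

Lemma wsum1 F : wsum 1 F = \sum_i F [:: i].
Proof. by rewrite wsumS; apply: eq_bigr => i _; rewrite wsum0. Qed.

Lemma wsum_rev k F : wsum k F = wsum k (fun w => F (rev w)).
Proof.
rewrite /wsum (reindex_inj (h := fun t : k.-tuple 'I_N => [tuple of rev t])) //.
by move=> s t /(congr1 val) /= /(can_inj revK) /val_inj.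
Qed.

Lemma wsumB k F G : wsum k (fun w => F w - G w) = wsum k F - wsum k G.
Proof. exact: sumrB. Qed.

Lemma wsumD k F G :
  wsum k (fun w => F w + G w) = wsum k F + wsum k G.
Proof. exact: big_split. Qed.

Lemma mulr_wsumr k x F : x * wsum k F = wsum k (fun w => x * F w).
Proof. exact: mulr_sumr. Qed.

Lemma mulr_wsuml k F x : wsum k F * x = wsum k (fun w => F w * x).
Proof. exact: mulr_suml. Qed.

Lemma exchange_wsum k l (F : seq 'I_N -> seq 'I_N -> freeZ N) :
  wsum k (fun u => wsum l (F u)) = wsum l (fun v => wsum k (F^~ v)).
Proof. exact: exchange_big. Qed.

End WordSums.

(** * Elementary functions as sums of decreasing words *)

Section ElementaryFunctions.
Variable N : nat.

Definition decreasing m (w : seq 'I_N) :=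
  sorted gtn (map val w) && all (fun i : 'I_N => (i < m)%N) w.

Lemma elemE k m :
  elem N k%:Z m = wsum k (fun w => if decreasing m w then word w else 0).
Proof. by rewrite /elem big_mkcond. Qed.

Lemma elem0 m : elem N 0 m = 1.
Proof. by rewrite elemE wsum0 -word_nil. Qed.

End ElementaryFunctions.

(** * Determinants with noncommuting entries *)

Section RowOrderedDeterminant.
Variable R : pzRingType.
Implicit Type A : nat -> nat -> R.

(** The factors are multiplied in the order of the rows. Entries are indexed by natural numbers, so
    a minor is again a [rowdet], with shifted indices. *)
Definition rowdet m A : R :=
  \sum_(s : 'S_m) (-1) ^+ s * \prod_(i < m) A i (s i).

Lemma eq_rowdet m A B : (forall i j, (i < m)%N -> (j < m)%N -> A i j = B i j) ->
  rowdet m A = rowdet m B.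
Proof.
move=> eqAB; apply: eq_bigr => s _; congr (_ * _).
by apply: eq_bigr => i _; rewrite eqAB.
Qed.

(** Permutations are sorted by the row [i] that they send to column 0; those with a given [i] are
    the [lift_perm i ord0 s]. The entry of column 0 stays in its place in the product, as it need
    not commute with the others. *)
Lemma rowdet_col0 m A : rowdet m.+1 A =
  \sum_(i < m.+1) \sum_(s : 'S_m)
    (-1) ^+ i * (-1) ^+ s * \prod_(k < m.+1) A k (lift_perm i ord0 s k).
Proof.
rewrite /rowdet (partition_big (fun s : 'S_m.+1 => s^-1%g ord0) predT) //=.
apply: eq_bigr => i0 _.
rewrite (reindex (lift_perm i0 ord0)) /=; last first.
  have lift_perm_inj : injective (lift_perm i0 (ord0 : 'I_m.+1)).
    move=> s t eq_st; apply/permP => k; apply: (@lift_inj _ ord0).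
    by rewrite -!(lift_perm_lift i0) eq_st.
  have lift_perm_onto (s : 'S_m.+1) :
    s i0 = ord0 -> exists t, lift_perm i0 ord0 t = s.
    (* The default [k] is never reached: only [i0] is sent to [ord0], and [lift i0 k] differs from
       [i0]. *)
    move=> si0; pose f k := odflt k (unlift ord0 (s (lift i0 k))).
    have fK k : lift ord0 (f k) = s (lift i0 k).
      rewrite /f; case: unliftP => [j ->|s0] //=; have := neq_lift i0 k.
      by rewrite -(inj_eq (@perm_inj _ s)) si0 s0 eqxx.
    have f_inj : injective f.
      by move=> k l /(congr1 (lift ord0)); rewrite !fK => /perm_inj/lift_inj.
    exists (perm f_inj); apply/permP => k.
    by case: (unliftP i0 k) => [j|] ->;
      rewrite ?lift_perm_id // lift_perm_lift permE fK.
  (* The inverse is found by search; [1%g] is a default for permutations outside the image. *)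
  exists (fun s => odflt 1%g [pick t | lift_perm i0 ord0 t == s]) => s.
    by case: pickP => [t /eqP/lift_perm_inj|/(_ s)]; rewrite ?eqxx.
  rewrite unfold_in => /eqP s0; case: pickP => [t /eqP //|none].
  have [|t def_s] := lift_perm_onto s; first by rewrite -s0 permKV.
  by have /eqP := none t.
apply: eq_big => [s|s _].
  by rewrite -(inj_eq (@perm_inj _ (lift_perm i0 ord0 s))) permKV lift_perm_id
             eqxx.
congr (_ * _).
by rewrite odd_lift_perm /= addbF signr_addb signr_odd.
Qed.

Lemma lift_permE m (i j : 'I_m.+1) k k' (s : 'S_m) :
  lift i k = k' -> lift_perm i j s k' = lift j (s k).
Proof. by move=> <-; rewrite lift_perm_lift. Qed.

Lemma rowdet1 A : rowdet 1 A = A 0%N 0%N.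
Proof.
rewrite /rowdet (big_pred1 (1%g : 'S_1)) => [|s]; last first.
  by apply/esym/eqP/permP => i; rewrite !ord1.
by rewrite odd_perm1 mul1r big_ord1 perm1.
Qed.

Lemma rowdet2 A :
  rowdet 2 A = A 0%N 0%N * A 1%N 1%N - A 0%N 1%N * A 1%N 0%N.
Proof.
rewrite rowdet_col0 big_ord_recl big_ord1 /=.
have S1 (s : 'S_1) : s = 1%g by apply/permP => i; rewrite !ord1.
rewrite !(big_pred1 (1%g : 'S_1)) => [| s | s]; last 2 first.
- by rewrite /= [s]S1 eqxx.
- by rewrite /= [s]S1 eqxx.
rewrite odd_perm1 !mulr1 mul1r expr1 mulN1r !big_ord_recl !big_ord0 !mulr1.
rewrite lift_perm_lift perm1 !lift_perm_id.
by rewrite (@lift_permE _ _ _ ord0) ?perm1 //; apply: val_inj.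
Qed.

(** Only rows 0 and 1 contribute to the expansion along column 0. The entry of row 0 is the leftmost
    factor and can be pulled out; that of row 1 is 1, so its place in the product is harmless.
    [bump 1] skips row 1. *)
Lemma rowdet_hessenberg m A :
    A 1%N 0%N = 1 -> (forall i, A i.+2 0%N = 0) ->
  rowdet m.+2 A = A 0%N 0%N * rowdet m.+1 (fun i j => A i.+1 j.+1)
                  - rowdet m.+1 (fun i j => A (bump 1 i) j.+1).
Proof.
move=> A10 A20; rewrite rowdet_col0 2!big_ord_recl [X in _ + (_ + X)]big1.
  rewrite addr0 /rowdet; congr (_ + _).
    rewrite big_distrr /=; apply: eq_bigr => s _.
    rewrite expr0 mul1r big_ord_recl lift_perm_id.
    rewrite !mulrA -commr_sign; congr (_ * _); apply: eq_bigr => k _.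
    by rewrite lift_perm_lift.
  rewrite -sumrN; apply: eq_bigr => s _.
  rewrite expr1 mulN1r mulNr; congr (- (_ * _)).
  rewrite big_ord_recl [in RHS]big_ord_recl big_ord_recl lift_perm_id A10 mul1r.
  congr (_ * _); first by rewrite (@lift_permE _ _ _ ord0) //; apply: val_inj.
  apply: eq_bigr => k _.
  by rewrite (@lift_permE _ _ _ (lift ord0 k)) //; apply: val_inj.
move=> i _; apply: big1 => s _.
suff -> : \prod_(k < m.+2) A k (lift_perm (lift ord0 (lift ord0 i)) ord0 s k)
          = 0.
  by rewrite mulr0.
(* The zero factor may sit in the middle of a noncommutative product, so the enumeration of rows is
   split at [j]. *)
set j := lift ord0 _.
have jin : j \in index_enum 'I_m.+2 by rewrite mem_index_enum.
case/splitPr: jin => p1 p2.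
by rewrite big_cat big_cons /= lift_perm_id A20 mul0r mulr0.
Qed.

End RowOrderedDeterminant.

(** * The flagged determinant of a hook *)

Section Hooks.
Variable N : nat.
Local Arguments elem : simpl never.

Definition flagged (v : seq 'I_N) (n : seq nat) :=
  all2 (fun (i : 'I_N) m => (i < m)%N) v n.

Lemma flaggedJE (al n : seq nat) :
  flaggedJ N al n = rowdet (size al) (fun i j =>
    elem N ((nth 0%N al i)%:Z + j%:Z - i%:Z) (nth 0%N n i)).
Proof. by []. Qed.

Lemma eq_elem d d' m : d = d' -> elem N d m = elem N d' m.
Proof. by move=> ->. Qed.

Lemma elem_lt0 d m : (d < 0)%R -> elem N d m = 0.
Proof. by case: d. Qed.

(** Column 0 reads e_a, e_0 = 1, then elementary functions of negative degree. Deleting column 0 and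
    row 1 raises the degrees of row 0 by one; rows below the deleted one shift along with the
    columns and keep their degrees. *)
Lemma flaggedJ_hook_rec a b m1 m2 n :
  flaggedJ N (a :: nseq b.+1 1%N) (m1 :: m2 :: n) =
  elem N a m1 * flaggedJ N (1%N :: nseq b 1%N) (m2 :: n)
  - flaggedJ N (a.+1 :: nseq b 1%N) (m1 :: n).
Proof.
have nth1 k c : (k < c)%N -> nth 0%N (nseq c 1%N) k = 1%N.
  by rewrite nth_nseq => ->.
rewrite !flaggedJE /= !size_nseq rowdet_hessenberg /=; last 2 first.
- by rewrite -[RHS](elem0 N m2); apply: eq_elem; lia.
- move=> i; rewrite nth_nseq; apply: elem_lt0.
  by case: ifP => _; lia.
have congr_mulB (x x1 y y1 z z1 : freeZ N) :
  x = x1 -> y = y1 -> z = z1 -> x * y - z = x1 * y1 - z1 by move=> -> -> ->.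
apply: congr_mulB.
- by apply: eq_elem; lia.
- apply: eq_rowdet => -[|i] j ib jb /=; first by apply: eq_elem; lia.
  by rewrite nth1; [apply: eq_elem; lia | lia].
apply: eq_rowdet => -[|i] j ib jb.
  by rewrite (_ : bump 1 0 = 0%N) //=; apply: eq_elem; lia.
by rewrite (_ : bump 1 i.+1 = i.+2) //= !nth1 ?(ltnW ib).
Qed.

(* The subtracted term cancels the words whose letter after u is smaller than
   the last letter of u; its missing flag m2 is implied by m <= m2. *)
Lemma flaggedJ_hook a b m n : size n = b -> path leq m n ->
  flaggedJ N (a.+1 :: nseq b 1%N) (m :: n) =
  wsum a.+1 (fun u => wsum b (fun v =>
    if [&& decreasing m u, path leq (last 0%N (map val u)) (map val v)
         & flagged v n] then word (u ++ v) else 0)).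
Proof.
elim: b a m n => [|b IHb] a m n.
  case: n => // _ _; rewrite flaggedJE rowdet1 /= addr0 subr0 elemE.
  by apply: eq_wsum => u _; rewrite wsum0 cats0 andbT.
case: n => // m2 n [sz_n] /= /andP[le_m pn].
rewrite flaggedJ_hook_rec !IHb //; last by apply: (@path_le _ _ leq_trans _ m2).
(* The words of length [a.+2] in the subtracted term are cut before their last letter, which is
   matched with the first letter [y] coming from the second factor. *)
rewrite elemE mulr_wsuml -[a.+2]addn1 wsum_cat -wsumB.
apply: eq_wsum => u size_u; rewrite mulr_wsumr -wsumB -[b.+1]add1n wsum_cat.
apply: eq_wsum => -[|y []] // _.
rewrite mulr_wsumr -wsumB; apply: eq_wsum => v size_v.
rewrite -catA /= /decreasing /= map_cat last_cat /= all_cat /= andbT.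
case: u size_u => // x u _ /=; rewrite cat_path /= last_map.
have lt_last : all (fun i : 'I_N => (i < m)%N) (x :: u) -> (last x u < m)%N.
  by move/allP; apply; apply: mem_last.
rewrite andbT andbACA; case: (path gtn _ _) => /=; last by rewrite mul0r subr0.
case: (boolP ((x < m)%N && _)) => [/lt_last lt_m|_] /=; last first.
  by rewrite mul0r !andbF subr0.
rewrite andbT -cat_cons word_cat.
case: (path leq y _); last by rewrite !andbF /= mulr0 subr0.
case: (flagged v n); last by rewrite !andbF /= mulr0 subr0.
rewrite !andbT; case: (ltnP y (last x u)) => [lt_y|le_y] /=.
  have lt_ym := ltn_trans lt_y lt_m.
  by rewrite lt_ym (leq_trans lt_ym le_m) subrr.
by case: ifP; rewrite ?mulr0 subr0.
Qed.

End Hooks.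

(** * Congruence modulo the ideal *)

Section Congruence.
Variable N : nat.
Implicit Types x y z : freeZ N.

Lemma I_KRst_opp x : I_KRst x -> I_KRst (- x).
Proof. by move=> Ix; rewrite -mulN1r; apply: tsi_mull. Qed.

Lemma I_KRst_sum (I : Type) (r : seq I) (P : pred I) (F : I -> freeZ N) :
  (forall i, P i -> I_KRst (F i)) -> I_KRst (\sum_(i <- r | P i) F i).
Proof.
by move=> IF; apply: big_ind => //; [apply: tsi_zero | apply: tsi_add].
Qed.

Lemma I_KRst_word w : ~~ uniq w -> I_KRst (word w : freeZ N).
Proof. by move=> rep; apply/tsi_gen/KRst_repeat. Qed.

Lemma eq_KRst_refl x : eq_KRst x x.
Proof. by rewrite /eq_KRst subrr; apply: tsi_zero. Qed.

Lemma eq_KRst_trans y x z : eq_KRst x y -> eq_KRst y z -> eq_KRst x z.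
Proof. by move=> xy yz; rewrite /eq_KRst -(subrKA y); apply: tsi_add. Qed.

Lemma eq_KRst_add x y z (t : freeZ N) :
  eq_KRst x y -> eq_KRst z t -> eq_KRst (x + z) (y + t).
Proof. by move=> xy zt; rewrite /eq_KRst opprD addrACA; apply: tsi_add. Qed.

Lemma eq_KRst_mull (w x y : freeZ N) : eq_KRst x y -> eq_KRst (w * x) (w * y).
Proof.
have distr (R : pzRingType) (u v t : R) : u * v - u * t = u * (v - t).
  by rewrite mulrBr.
by move=> xy; rewrite /eq_KRst distr; apply: tsi_mull.
Qed.

Lemma eq_KRst_sum (I : Type) (r : seq I) (P : pred I) (F G : I -> freeZ N) :
  (forall i, P i -> eq_KRst (F i) (G i)) ->
  eq_KRst (\sum_(i <- r | P i) F i) (\sum_(i <- r | P i) G i).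
Proof. by move=> eqFG; rewrite /eq_KRst -sumrB; apply: I_KRst_sum. Qed.

Lemma eq_KRst_wsum k (F G : seq 'I_N -> freeZ N) :
  (forall w, size w = k -> eq_KRst (F w) (G w)) ->
  eq_KRst (wsum k F) (wsum k G).
Proof.
by move=> eqFG; apply: eq_KRst_sum => w _; apply: eqFG; rewrite size_tuple.
Qed.

(** Words with a repeated letter vanish, so two selection conditions need to be compared on words
    with distinct letters only. *)
Lemma eq_KRst_uniq (P Q : bool) w : (uniq w -> P = Q) ->
  eq_KRst (if P then word w else 0 : freeZ N) (if Q then word w else 0).
Proof.
case: (boolP (uniq w)) => [_ -> //|rep _]; first exact: eq_KRst_refl.
have Iw := I_KRst_word rep.
case: P; case: Q; rewrite /eq_KRst ?subrr ?subr0 ?sub0r //.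
- exact: tsi_zero.
- exact: I_KRst_opp.
exact: tsi_zero.
Qed.

End Congruence.

(** * Tableau sums and hook tableaux *)

Section Tableaux.
Variable N : nat.
Implicit Types (T : tableau N) (r s : seq 'I_N).
Local Arguments column : simpl never.

(** A tableau is determined by its row word, read from the top. This brings tableau sums to the form
    of the determinant expansions, for comparison word by word. *)
Lemma sum_SYT mu n (P : pred (tableau N)) (f : tableau N -> seq 'I_N) :
  \sum_(T <- SYT N mu n | P T) word (f T) =
  wsum (sumn mu) (fun t => let T := reshape mu t in
    if is_syt n T && P T then word (f T) else 0).
Proof.
by rewrite /SYT big_filter_cond big_map big_enum_cond /= big_mkcond /=.
Qed.

Lemma reshape_nseq1 a s :
  size s = a -> reshape (nseq a 1%N) s = [seq [:: y] | y <- s].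
Proof. by elim: a s => [|a IHa] [|x s] //= [sz]; rewrite take0 drop0 IHa. Qed.

Lemma column_seq1 c s :
  column [seq [:: y] | y <- s] c = if c is 0%N then s else [::].
Proof.
rewrite /column; case: c => [|c]; elim: s => //= x s; first by move=> ->.
by rewrite onth0n.
Qed.

Section HookTableau.
Variables (x : 'I_N) (r s : seq 'I_N).
Let T := (x :: r) :: [seq [:: y] | y <- s].

Lemma column_hook0 : column T 0 = x :: s.
Proof. by rewrite -[in RHS](column_seq1 0 s). Qed.

Lemma column_hookS c : (c < size r)%N -> column T c.+1 = [:: nth x r c].
Proof.
move=> lt_c; have := column_seq1 c.+1 s; rewrite /column /= => ->.
by rewrite -(odflt_onth x); case: onth (onthTE r c) => //=; rewrite lt_c.
Qed.

Lemma creading_hook : creading T = rev (x :: s) ++ r.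
Proof.
rewrite /creading /= column_hook0 (iotaDl 1 0) -map_comp; congr (_ ++ _).
rewrite -[RHS](mkseq_nth x) /mkseq -[RHS]flatten_map1; congr flatten.
by apply/eq_in_map => c; rewrite mem_iota => /= lt_c; rewrite column_hookS.
Qed.

(** Each letter of the arm [r] is a column of its own, so its flag condition is [flagged r n].
    Distinctness is moved to the column reading, a permutation of the entries, to suit
    [eq_KRst_uniq]. *)
Lemma is_syt_hook m n : size n = size r ->
  is_syt (m :: n) T =
  [&& path leq x (map val r), path ltn x (map val s), uniq (rev (x :: s) ++ r),
      all (fun i : 'I_N => (i < m)%N) (x :: s) & flagged r n].
Proof.
move=> size_n; rewrite /is_syt /= flatten_map1 map_id.
have -> : all (fun t => sorted leq (map val t)) [seq [:: y] | y <- s].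
  by rewrite all_map; apply/allP.
have -> : all (fun c => sorted ltn (map val (column T c))) (iota 1 (size r)).
  rewrite (iotaDl 1 0) all_map; apply/allP => c; rewrite mem_iota /= => lt_c.
  by rewrite column_hookS.
have -> : all (fun c => all (fun i : 'I_N => (i < nth 0 (m :: n) c)%N)
                            (column T c)) (iota 1 (size r)) = flagged r n.
  rewrite (iotaDl 1 0) all_map.
  transitivity (all (fun c => (nth x r c < nth 0%N n c)%N) (iota 0 (size r))).
    apply: eq_in_all => c; rewrite mem_iota /= => lt_c.
    by rewrite column_hookS //= andbT.
  elim: (r) n size_n => [|y r' IHr] [|k n'] //= [size_n].
  by rewrite (iotaDl 1 0) all_map -IHr.
rewrite column_seq1 !andbT -/(uniq (x :: r ++ s)); congr [&& _, _, _ & _].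
apply/perm_uniq/(@perm_trans _ ((x :: s) ++ r)).
  by rewrite /= perm_cons perm_catC.
by rewrite perm_cat2r perm_sym perm_rev.
Qed.

End HookTableau.
End Tableaux.

(** * The identity for hooks *)

Lemma conjugate_hook a b :
  conjugate (a.+1 :: nseq b 1%N) = b.+1 :: nseq a 1%N.
Proof.
rewrite /conjugate /= count_nseq mul1n (iotaDl 1 0) -map_comp; congr (_ :: _).
apply: (@eq_from_nth _ 0%N) => [|i]; rewrite size_map size_iota ?size_nseq //.
move=> lt_i; rewrite (nth_map 0%N) ?size_iota // nth_iota // nth_nseq lt_i /=.
by rewrite count_nseq /= add0n mul0n addn0 add1n ltnS lt_i.
Qed.

Section HookTheorem.
Variable N : nat.

Lemma decreasing_rev m (x : 'I_N) s :
  decreasing m (rev (x :: s)) =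
  path ltn x (map val s) && all (fun i : 'I_N => (i < m)%N) (x :: s).
Proof. by rewrite /decreasing map_rev rev_sorted all_rev. Qed.

(** In a word [u ++ v] of the expansion, [u] reversed is the first column and [v] the rest of the
    first row; the condition at the junction says that the row increases from the corner. *)
Lemma flaggedJ_hook_SYT a b m n : size n = b -> path leq m n ->
  eq_KRst (flaggedJ N (a.+1 :: nseq b 1%N) (m :: n))
    (\sum_(T <- SYT N (conjugate (a.+1 :: nseq b 1%N)) (m :: n))
        word (creading T)).
Proof.
move=> size_n pn; rewrite flaggedJ_hook // sum_SYT conjugate_hook /=.
(* Reversing [u] brings its last letter, the corner [x] of the tableau, to the front. *)
rewrite sumn_nseq mul1n wsum_rev !wsumS; apply: eq_KRst_sum => x _.
rewrite wsum_cat exchange_wsum; apply: eq_KRst_wsum => r size_r.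
apply: eq_KRst_wsum => s size_s.
rewrite (_ : _ :: reshape _ _ = (x :: r) :: [seq [:: y] | y <- s]); last first.
  by rewrite /= take_size_cat // drop_size_cat // reshape_nseq1.
rewrite is_syt_hook ?size_n ?size_r // creading_hook andbT.
apply: eq_KRst_uniq => uniq_w; rewrite decreasing_rev uniq_w.
rewrite rev_cons map_rcons last_rcons.
by case: (path ltn _ _); case: (path leq _ _) => //=; rewrite andbF.
Qed.

End HookTheorem.

(** * The shape (a, 2) *)

Lemma conjugate_tworows a :
  conjugate [:: a.+2; 2%N] = [:: 2%N, 2%N & nseq a 1%N].
Proof.
rewrite /conjugate /= (iotaDl 2 0) -map_comp; do 2!congr (_ :: _).
apply: (@eq_from_nth _ 0%N) => [|i]; rewrite size_map size_iota ?size_nseq //.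
move=> lt_i; rewrite (nth_map 0%N) ?size_iota // nth_iota // nth_nseq lt_i /=.
by rewrite !ltnS add0n lt_i.
Qed.

(* The coefficient of the word pijk in the determinant, minus that in the
   tableau sum, minus that in the sum of the relations
   acb + bca - bac - cab over a < b < c with b < p and c < m. *)
Lemma triple_coefficients (m p i j k : nat) :
  [&& [&& p != i, p != j & p != k], (i != j) && (i != k) & j != k] ->
  (p < m)%N ->
  [&& (i < p)%N, (k < j)%N & (j < m)%N]%:Z -
  [&& (i < p)%N, (j < i)%N & (k < m)%N]%:Z -
  ([&& (i < p)%N, (p < k)%N, (k < j)%N & (j < m)%N]%:Z +
   [&& (j < k)%N, (k < p)%N, (p < i)%N & (i < m)%N]%:Z) -
  ([&& (i < k)%N, (k < j)%N, (k < p)%N & (j < m)%N]%:Z +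
   [&& (k < i)%N, (i < j)%N, (i < p)%N & (j < m)%N]%:Z -
   [&& (j < i)%N, (i < k)%N, (i < p)%N & (k < m)%N]%:Z -
   [&& (j < k)%N, (k < i)%N, (k < p)%N & (i < m)%N]%:Z) =
  0 :> int.
Proof.
move=> dist lt_pm.
have lt_m x : (x < p)%N -> (x < m)%N by move/ltn_trans; apply.
case: (ltngtP i p) dist => [lt_ip|lt_pi|_]; last by rewrite ?eqxx ?andbF.
all: case: (ltngtP j p) => [lt_jp|lt_pj|_]; last by rewrite ?eqxx ?andbF.
all: case: (ltngtP k p) => [lt_kp|lt_pk|_]; last by rewrite ?eqxx ?andbF.
(* Letters below [p] are below [m]; the bounds on the other letters remain as unknown truth
   values. *)
all: rewrite ?(lt_m _ lt_ip) ?(lt_m _ lt_jp) ?(lt_m _ lt_kp) {lt_m}.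
all: case: (ltngtP i j) => [lt_ij|lt_ji|_]; last by rewrite ?eqxx ?andbF.
all: case: (ltngtP i k) => [lt_ik|lt_ki|_]; last by rewrite ?eqxx ?andbF.
all: case: (ltngtP j k) => [lt_jk|lt_kj|_]; last by rewrite ?eqxx ?andbF.
all: move=> _ //=.
all: rewrite ?subr0 ?addr0 ?add0r ?subrr ?sub0r ?opprK //.
all: lia.
Qed.

Section TwoRows.
Variable N : nat.
Local Arguments column : simpl never.
Local Arguments elem : simpl never.

Definition sum3 (F : 'I_N -> 'I_N -> 'I_N -> freeZ N) : freeZ N :=
  \sum_i \sum_j \sum_k F i j k.

Lemma eq_sum3 F G : (forall i j k, F i j k = G i j k) -> sum3 F = sum3 G.
Proof. by move=> eqFG; do 3!apply: eq_bigr => ? _. Qed.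

Lemma sum3B F G : sum3 (fun i j k => F i j k - G i j k) = sum3 F - sum3 G.
Proof.
by rewrite /sum3 -sumrB; do 2!(apply: eq_bigr => ? _; rewrite -sumrB).
Qed.

Lemma sum3D F G : sum3 (fun i j k => F i j k + G i j k) = sum3 F + sum3 G.
Proof.
by rewrite /sum3 -big_split; do 2!(apply: eq_bigr => ? _; rewrite -big_split).
Qed.

Lemma sum3_swap23 F : sum3 F = sum3 (fun i j k => F i k j).
Proof. by apply: eq_bigr => i _; apply: exchange_big. Qed.

Lemma sum3_swap12 F : sum3 F = sum3 (fun i j k => F j i k).
Proof. exact: exchange_big. Qed.

Definition triples (c : 'I_N -> 'I_N -> 'I_N -> int) : freeZ N :=
  sum3 (fun i j k => word [:: i; j; k] *~ c i j k).

Lemma triplesB c d :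
  triples c - triples d = triples (fun i j k => c i j k - d i j k).
Proof. by rewrite -sum3B; apply: eq_sum3 => i j k; rewrite mulrzBr. Qed.

Lemma triplesD c d :
  triples c + triples d = triples (fun i j k => c i j k + d i j k).
Proof. by rewrite -sum3D; apply: eq_sum3 => i j k; rewrite mulrzDr. Qed.

Lemma letterM3 (a b c : 'I_N) :
  letter a * letter b * letter c = word [:: a; b; c].
Proof.
rewrite /letter -(word_cat [:: a] [:: b]).
by rewrite -(word_cat ([:: a] ++ [:: b]) [:: c]).
Qed.

(** Each triple selected by [t] contributes acb + bca - bac - cab, the opposite of a generator. The
    statement collects these by the word ijk, which can play any of the four roles. *)
Lemma I_KRst_triples (t : 'I_N -> 'I_N -> 'I_N -> bool) :
  (forall a b c, t a b c -> (a < b < c)%N) ->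
  I_KRst (triples (fun i j k =>
    (t i k j)%:Z + (t k i j)%:Z - (t j i k)%:Z - (t j k i)%:Z)).
Proof.
move=> t_inc.
rewrite -!triplesB -triplesD /triples.
(* Each of the four sums is reindexed so that its coefficient becomes [t a b c]. *)
rewrite [X in X + _ - _ - _]sum3_swap23.
rewrite [X in _ + X - _ - _]sum3_swap23 [X in _ + X - _ - _]sum3_swap12.
rewrite [X in _ - X - _]sum3_swap12.
rewrite [X in _ - _ - X]sum3_swap12 [X in _ - _ - X]sum3_swap23.
rewrite -sum3D -!sum3B.
apply: I_KRst_sum => a _; apply: I_KRst_sum => b _; apply: I_KRst_sum => c _.
have distr (V : zmodType) (x y z w : V) (e : int) :
  x *~ e + y *~ e - z *~ e - w *~ e = (x + y - z - w) *~ e.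
  by rewrite !mulrzBl mulrzDl.
rewrite distr.
case: (boolP (t a b c)) => [/t_inc /andP[lt_ab lt_bc] | _]; last first.
  by rewrite mulr0z; apply: tsi_zero.
rewrite mulr1z.
have := I_KRst_opp (tsi_gen (KRst_triple lt_ab lt_bc)).
have expand (R : pzRingType) (x y z w1 w2 w3 w4 : R) :
    x * z * y = w1 -> y * z * x = w2 -> y * x * z = w3 -> z * x * y = w4 ->
  - (y * (x * z - z * x) - (x * z - z * x) * y) = w1 + w2 - w3 - w4.
  move=> <- <- <- <-.
  by rewrite mulrBr mulrBl !opprB addrACA [X in _ + X]addrC addrA !mulrA.
by rewrite (expand _ _ _ _ _ _ _ _ (letterM3 a c b) (letterM3 b c a)
                   (letterM3 b a c) (letterM3 c a b)).
Qed.

(** The factor [p] on the left makes every word in which i, j or k equals [p] vanish, so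
    coefficients are compared for four distinct letters only. *)
Lemma triples_relation (p : 'I_N) m : (p < m)%N ->
  eq_KRst
    (word [:: p] * triples (fun i j k =>
       [&& i < p, k < j & j < m]%N%:Z - [&& i < p, j < i & k < m]%N%:Z))
    (word [:: p] * triples (fun i j k =>
       [&& i < p, p < k, k < j & j < m]%N%:Z
       + [&& j < k, k < p, p < i & i < m]%N%:Z)).
Proof.
move=> lt_pm; rewrite /eq_KRst -mulrBr triplesB.
pose t (a b c : 'I_N) := [&& a < b, b < c, b < p & c < m]%N.
have t_inc a b c : t a b c -> (a < b < c)%N by case/and4P => -> ->.
have := tsi_mull (word [:: p]) (I_KRst_triples t_inc).
set r := triples _; set d := triples _ => Ir.
(* Once the relations [r] are subtracted, each remaining word has coefficient 0 or a repeated
   letter. *)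
rewrite -(subrK (word [:: p] * r) (_ * d)); apply: tsi_add => //.
rewrite -mulrBr triplesB /triples.
rewrite mulr_sumr; apply: I_KRst_sum => i _.
rewrite mulr_sumr; apply: I_KRst_sum => j _.
rewrite mulr_sumr; apply: I_KRst_sum => k _.
rewrite mulrzAr -word_cat /=.
case: (boolP (uniq [:: p; i; j; k])) => [|rep]; last first.
  by rewrite -mulrzr; apply: tsi_mulr; apply: I_KRst_word.
rewrite /= !inE !negb_or -!val_eqE /= !andbT => dist.
set z : int := (_ - _ - _)%R.
suff -> : z = 0 by rewrite mulr0z; apply: tsi_zero.
exact: triple_coefficients.
Qed.

(** This describes the first column from its second row down: [p] is the entry in row 2, and the
    corner is left among the three remaining letters. *)
Definition strict_column m (p : 'I_N) (s : seq 'I_N) :=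
  path ltn p (map val s) && all (fun i : 'I_N => (i < m)%N) (p :: s).

(** The letters of [t] lie below [p], hence inherit its bound [m]; [p] is the only link between the
    two parts. *)
Lemma decreasing_rev_cat m (p : 'I_N) s t :
  decreasing m (rev (p :: s) ++ t) =
  strict_column m p s && path gtn (val p) (map val t).
Proof.
have sorted_rcons_cat (e : rel nat) u x v :
  sorted e (rcons u x ++ v) = sorted e (rcons u x) && path e x v.
  by case: u => //= y u; rewrite cat_path last_rcons.
rewrite /decreasing map_cat all_cat rev_cons map_rcons sorted_rcons_cat.
rewrite -map_rcons -rev_cons map_rev rev_sorted all_rev /strict_column /=.
case: (boolP (path gtn _ _)) => [pt|_]; last by rewrite !andbF.
rewrite !andbT; case: (boolP (path _ _ _)) => //= _.
case: (ltnP p m) => //= lt_pm; case: (all _ s) => //=.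
have /allP lt_tp := order_path_min (rev_trans ltn_trans) pt.
by apply/allP => i t_i; apply: ltn_trans lt_pm; apply/lt_tp/map_f.
Qed.

Lemma elem_split k a m :
  elem N (a.+1 + k)%N m = wsum a (fun s => \sum_p if strict_column m p s then
     word (rev (p :: s)) *
     wsum k (fun t => if path gtn (val p) (map val t) then word t else 0)
   else 0).
Proof.
rewrite elemE wsum_cat wsum_rev wsumS [LHS]exchange_big.
rewrite [RHS]/wsum; apply: eq_bigr => s _; apply: eq_bigr => p _.
case: ifP => p_s; last by apply: big1 => t _; rewrite decreasing_rev_cat p_s.
rewrite mulr_wsumr; apply: eq_wsum => t _.
by rewrite decreasing_rev_cat p_s word_cat /=; case: ifP; rewrite ?mulr0.
Qed.

Lemma mul_if_word (b c d : bool) (u v : seq 'I_N) : b && c = d ->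
  (if b then word u else 0) * (if c then word v else 0)
  = word (u ++ v) *~ d%:Z :> freeZ N.
Proof.
move=> <-; case: b; case: c; rewrite ?mul0r ?mulr0 ?mulr0z //.
by rewrite mulr1z word_cat.
Qed.

Lemma congr_sub (x y z t : freeZ N) : x = y -> z = t -> x - z = y - t.
Proof. by move=> -> ->. Qed.

Lemma congr_if (b : bool) (x y z : freeZ N) :
  x = y -> (if b then x else z) = (if b then y else z).
Proof. by move=> ->. Qed.

(** Both products of the determinant are sums over the same prefixes, so their difference can be
    taken prefix by prefix. *)
Lemma prefix_sumB a (c : 'I_N -> seq 'I_N -> bool)
    (W : 'I_N -> seq 'I_N -> freeZ N) (K L : 'I_N -> freeZ N) x y :
  wsum a (fun s => \sum_p if c p s then W p s * K p else 0) * x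
  - wsum a (fun s => \sum_p if c p s then W p s * L p else 0) * y
  = wsum a (fun s => \sum_p if c p s then W p s * (K p * x - L p * y) else 0).
Proof.
apply: etrans; first by apply: congr_sub; apply: mulr_wsuml.
rewrite -wsumB; apply: eq_wsum => s _.
apply: etrans; first by apply: congr_sub; apply: mulr_suml.
rewrite -sumrB; apply: eq_bigr => p _.
have distr (R : pzRingType) (w k l u v : R) :
    w * k * u - w * l * v = w * (k * u - l * v) by rewrite mulrBr !mulrA.
have zero (R : pzRingType) (u v : R) : 0 * u - 0 * v = 0.
  by rewrite !mul0r subr0.
by case: (c p s); [apply: distr | apply: zero].
Qed.

Lemma flaggedJ_tworows a m1 m2 :
  flaggedJ N [:: a.+2; 2%N] [:: m1; m2] =
  wsum a (fun s => \sum_(p : 'I_N) if strict_column m1 p s then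
    word (rev (p :: s)) *
    triples (fun i j k =>
      [&& i < p, k < j & j < m2]%N%:Z - [&& i < p, j < i & k < m2]%N%:Z)
  else 0).
Proof.
rewrite flaggedJE rowdet2 /=.
have congr_mulB (x y z t x' y' z' t' : freeZ N) :
  x = x' -> y = y' -> z = z' -> t = t' -> x * y - z * t = x' * y' - z' * t'.
  by move=> -> -> -> ->.
(* The first factors have a common prefix of length [a.+1]; what follows it has 1 + 2 letters in one
   product and 2 + 1 in the other. *)
transitivity (elem N (a.+1 + 1)%N m1 * elem N 2%N m2
              - elem N (a.+1 + 2)%N m1 * elem N 1%N m2).
  by apply: congr_mulB; apply: eq_elem; lia.
rewrite (elem_split 1 a).
rewrite (elem_split 2 a).
rewrite prefix_sumB.
apply: eq_wsum => s _; apply: eq_bigr => p _.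
apply: congr_if; apply: congr1; rewrite -triplesB !elemE.
apply: congr_sub.
  rewrite wsum1 mulr_suml; apply: eq_bigr => i _.
  rewrite wsumS mulr_sumr; apply: eq_bigr => j _.
  rewrite wsum1 mulr_sumr; apply: eq_bigr => k _.
  apply: mul_if_word; rewrite /decreasing /= !andbT.
  case: (ltnP k j) => //= lt_kj; case: (ltnP j m2) => //= lt_jm.
  by rewrite (ltn_trans lt_kj lt_jm).
rewrite wsumS mulr_suml; apply: eq_bigr => i _.
rewrite wsum1 mulr_suml; apply: eq_bigr => j _.
rewrite wsum1 mulr_sumr; apply: eq_bigr => k _.
by apply: mul_if_word; rewrite /decreasing /= !andbT andbA.
Qed.

Section Tableau.
Variables (x z y t : 'I_N) (s : seq 'I_N).
Let T := [:: x; z] :: [:: y; t] :: [seq [:: p] | p <- s].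

Lemma column_tworows0 : column T 0 = [:: x, y & s].
Proof. by rewrite -[in RHS](column_seq1 0 s). Qed.

Lemma column_tworows1 : column T 1 = [:: z; t].
Proof. by rewrite -[in RHS](column_seq1 1 s). Qed.

(** Both readings start with [rev (y :: s)], so [y] plays the part of [p]; they differ only in the
    order of [x] and [t]. *)
Lemma creading_tworows : creading T = rev (y :: s) ++ [:: x; t; z].
Proof.
rewrite /creading /= column_tworows0 column_tworows1 cats0.
by rewrite rev_cons cat_rcons.
Qed.

Lemma reading_tworows : reading T = rev (y :: s) ++ [:: t; x; z].
Proof.
rewrite /reading /T !rev_cons !flatten_rcons -map_rev flatten_map1 map_id.
by rewrite cat_rcons -catA.
Qed.

Lemma is_syt_tworows m1 m2 : is_syt [:: m1; m2] T =
  [&& (x <= z) && (y <= t), path ltn x (map val (y :: s)) && (z < t),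
      uniq (rev (y :: s) ++ [:: x; t; z]),
      all (fun i : 'I_N => (i < m1)%N) [:: x, y & s] & (z < m2) && (t < m2)]%N.
Proof.
have -> : is_syt [:: m1; m2] T = [&&
    all (fun r => sorted leq (map val r)) T,
    sorted ltn (map val (column T 0)) && sorted ltn (map val (column T 1)),
    uniq (flatten T), all (fun i : 'I_N => (i < m1)%N) (column T 0)
    & all (fun i : 'I_N => (i < m2)%N) (column T 1)].
  by rewrite /is_syt /= !andbT.
rewrite column_tworows0 column_tworows1.
have -> : uniq (flatten T) = uniq (rev (y :: s) ++ [:: x; t; z]).
  apply/perm_uniq/seq.permP => P.
  by rewrite /= flatten_map1 map_id count_cat count_rev /=; lia.
have -> : all (fun r => sorted leq (map val r)) T = (x <= z)%N && (y <= t)%N.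
  by rewrite /= all_map (eq_all (a2 := predT)) // all_predT !andbT.
by rewrite /= !andbT.
Qed.

End Tableau.

Lemma sum_SYT_tworows a m1 m2 (P : pred (tableau N)) f :
  \sum_(T <- SYT N (conjugate [:: a.+2; 2%N]) [:: m1; m2] | P T) word (f T) =
  \sum_x \sum_z \sum_y \sum_t wsum a (fun s =>
    let T := [:: x; z] :: [:: y; t] :: [seq [:: p] | p <- s] in
    if is_syt [:: m1; m2] T && P T then word (f T) else 0).
Proof.
rewrite sum_SYT conjugate_tworows (_ : sumn _ = a.+4); last first.
  by rewrite /= sumn_nseq mul1n.
rewrite wsumS; apply: eq_bigr => x _; rewrite wsumS; apply: eq_bigr => z _.
rewrite wsumS; apply: eq_bigr => y _; rewrite wsumS; apply: eq_bigr => t _.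
by apply: eq_wsum => s size_s; rewrite /= take0 drop0 reshape_nseq1.
Qed.

(** The sums are reordered from the row word to the column reading, with the prefix outermost as in
    the determinant. *)
Lemma exchange_prefix a
    (F : 'I_N -> 'I_N -> 'I_N -> 'I_N -> seq 'I_N -> freeZ N) :
  \sum_x \sum_z \sum_y \sum_t wsum a (F x z y t) =
  wsum a (fun s => \sum_y sum3 (fun x t z => F x z y t s)).
Proof.
transitivity (\sum_y \sum_x \sum_t \sum_z wsum a (F x z y t)).
  rewrite [RHS]exchange_big; apply: eq_bigr => x _.
  rewrite exchange_big; apply: eq_bigr => y _; exact: exchange_big.
rewrite [RHS]exchange_big; apply: eq_bigr => y _.
rewrite [RHS]exchange_big; apply: eq_bigr => x _.
rewrite [RHS]exchange_big; apply: eq_bigr => t _.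
by rewrite [RHS]exchange_big.
Qed.

Lemma prefix_triples (b : bool) u (c d : 'I_N -> 'I_N -> 'I_N -> bool) :
  (if b then word u * triples (fun i j k => (c i j k)%:Z + (d i j k)%:Z) else 0)
  = sum3 (fun i j k => if b && c i j k then word (u ++ [:: i; j; k]) else 0)
    + sum3 (fun i j k => if b && d i j k then word (u ++ [:: i; j; k]) else 0).
Proof.
rewrite -sum3D; case: b; last first.
  by apply/esym; do 3!(apply: big1 => ? _); rewrite addr0.
rewrite mulr_sumr; apply: eq_bigr => i _.
rewrite mulr_sumr; apply: eq_bigr => j _.
rewrite mulr_sumr; apply: eq_bigr => k _.
rewrite word_cat mulrzAr mulrzDr.
by case: (c i j k); case: (d i j k).
Qed.

Lemma word_rev_cons_mul (p : 'I_N) s (X : freeZ N) :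
  word (rev (p :: s)) * X = word (rev s) * (word [:: p] * X).
Proof. by rewrite rev_cons -cats1 word_cat mulrA. Qed.

(** Here p is T_{2,1}. The words with i < p < k < j are column readings, (i, j, k) being (T_{1,1},
    T_{2,2}, T_{1,2}); those with j < k < p < i are row readings, (i, j, k) being (T_{2,2}, T_{1,1},
    T_{1,2}). *)
Lemma flaggedJ_tworows_SYT a m1 m2 : (m1 <= m2)%N ->
  let la := [:: a.+2; 2%N] in
  eq_KRst (flaggedJ N la [:: m1; m2])
    (\sum_(T <- SYT N (conjugate la) [:: m1; m2] | (entry T 0 1 > entry T 1 0)%N)
        word (creading T)
     + \sum_(T <- SYT N (conjugate la) [:: m1; m2] | (entry T 0 1 < entry T 1 0)%N)
        word (reading T)).
Proof.
move=> le_m12 la; rewrite flaggedJ_tworows.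
apply: (@eq_KRst_trans _ (wsum a (fun s => \sum_(p : 'I_N)
    if strict_column m1 p s then word (rev (p :: s)) *
    triples (fun i j k => [&& i < p, p < k, k < j & j < m2]%N%:Z
                        + [&& j < k, k < p, p < i & i < m2]%N%:Z) else 0))).
  apply: eq_KRst_wsum => s _; apply: eq_KRst_sum => p _.
  case E: (strict_column m1 p s); last exact: eq_KRst_refl.
  rewrite !word_rev_cons_mul; apply/eq_KRst_mull/triples_relation.
  by apply: leq_trans le_m12; case/and3P: E.
rewrite !sum_SYT_tworows !exchange_prefix.
rewrite -wsumD; apply: eq_KRst_wsum => s _.
rewrite -big_split; apply: eq_KRst_sum => p _; rewrite prefix_triples.
apply: eq_KRst_add; last rewrite sum3_swap12.
  do 3!apply: eq_KRst_sum => ? _.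
  cbv zeta; rewrite creading_tworows is_syt_tworows.
  apply: eq_KRst_uniq => ->; rewrite /strict_column /entry /=.
  by case: (path _ _ _); case: (all _ _); lia.
apply: eq_KRst_sum => i _; apply: eq_KRst_sum => j _; apply: eq_KRst_sum => k _.
cbv zeta; rewrite reading_tworows is_syt_tworows.
have reorder :
  uniq (rev (p :: s) ++ [:: i; j; k]) = uniq (rev (p :: s) ++ [:: j; i; k]).
  by apply/perm_uniq; rewrite perm_cat2l (perm_catCA [:: i] [:: j]).
apply: eq_KRst_uniq => uniq_w; rewrite reorder uniq_w.
(* Distinctness of the letters turns the weak row inequalities of the tableau into strict ones. *)
move: uniq_w; rewrite rev_cons cat_rcons cat_uniq => /and3P[_ _].
rewrite /= !inE !negb_or -!val_eqE /strict_column /entry /=.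
by case: (path _ _ _); case: (all _ _); lia.
Qed.

End TwoRows.

(** * Nonnegative combinations of words *)

Section Positivity.
Variable N : nat.

Definition nonneg (p : freeZ N) := forall w, (0 <= p@_w)%R.

Lemma nonneg_word w : nonneg (word w).
Proof. by move=> v; rewrite mcoeffU mulrn_wge0. Qed.

Lemma nonneg_sum (I : Type) (r : seq I) (P : pred I) (f : I -> seq 'I_N) :
  nonneg (\sum_(i <- r | P i) word (f i)).
Proof.
by move=> w; rewrite raddf_sum; apply: sumr_ge0 => i _; apply: nonneg_word.
Qed.

Lemma nonneg_add p q : nonneg p -> nonneg q -> nonneg (p + q).
Proof. by move=> p_ge0 q_ge0 w; rewrite mcoeffD addr_ge0. Qed.

End Positivity.

Theorem theorem4p6 (N : nat) :
  (forall (l : nat) (n : l.-tuple nat),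
     sorted leq n -> all (fun m => (m <= N)%N) n ->
     (forall a b : nat, (1 <= a)%N -> l = b.+1 ->
        let la := a :: nseq b 1%N in
        eq_KRst (flaggedJ N la n)
          (\sum_(T <- SYT N (conjugate la) n) word (creading T)))
     /\
     (forall a : nat, (2 <= a)%N -> l = 2%N ->
        let la := [:: a; 2%N] in
        eq_KRst (flaggedJ N la n)
          (\sum_(T <- SYT N (conjugate la) n | (entry T 0 1 > entry T 1 0)%N)
              word (creading T)
           + \sum_(T <- SYT N (conjugate la) n | (entry T 0 1 < entry T 1 0)%N)
              word (reading T))))
  /\
  (forall la : seq nat,
     hook la \/ (exists a : nat, (2 <= a)%N /\ la = conjugate [:: a; 2%N]) ->
     positive_KRst (schurJ N la)).
Proof.
split=> [l n sorted_n _|la].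
  split=> [[//|a] b _ def_l la | [|[|a]] // _ def_l la].
    case: n sorted_n => -[|m n] /= /eqP; rewrite def_l // => -[size_n] path_n.
    exact: flaggedJ_hook_SYT.
  case: n sorted_n => -[|m1 [|m2 [|? ?]]] /= /eqP; rewrite def_l // => _.
  by rewrite andbT; apply: flaggedJ_tworows_SYT.
rewrite /schurJ; case=> [[[|a] [b [// _ ->]]] | [[|[|a]] [// _ ->]]].
  (* The conjugate of a hook is a hook, so the first identity applies with the constant flag [N]. *)
  rewrite conjugate_hook /= size_nseq.
  have path_N : path leq N (nseq a N) by elim: a => //= a ->; rewrite leqnn.
  have := flaggedJ_hook_SYT N b (size_nseq a N) path_N.
  by move=> JE; eexists; split; [apply: nonneg_sum | apply: JE].
(* [schurJ] conjugates its argument, which leads from (a, 2)' back to the determinant of (a, 2). *)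
have -> : conjugate (conjugate [:: a.+2; 2%N]) = [:: a.+2; 2%N].
  by rewrite conjugate_tworows /conjugate /= !count_nseq /= mul1n mul0n.
have JE := flaggedJ_tworows_SYT N a (leqnn N).
eexists; split; last exact: JE.
by apply: nonneg_add; apply: nonneg_sum.
Qed.
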